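(* Let $R$ be a ring. If $\varinjlim\mathcal P_1=\mathcal F_1$, then $\mathcal P_1\mathcal F(R)=\mathcal F_1^{\mathrm{fp}}\mathcal F(R)=\mathcal F_1\mathcal F(R)$.
   Context: $R$ is an associative ring with unit and modules are unital. $\mathcal F_1$ (resp. $\mathcal P_1$) is the class of right $R$-modules of flat (resp. projective) dimension at most $1$; $\mathcal F_1^{\mathrm{fp}}$ is the subclass of finitely presented modules in $\mathcal F_1$. A left $R$-module $M$ is $\mathcal F_1$-flat (resp. $\mathcal F_1^{\mathrm{fp}}$-flat, $\mathcal P_1$-flat) if $\mathrm{Tor}_1^R(H,M)=0$ for every $H$ in $\mathcal F_1$ (resp. $\mathcal F_1^{\mathrm{fp}}$, $\mathcal P_1$); the class of all such left modules is denoted $\mathcal F_1\mathcal F(R)$ (resp. $\mathcal F_1^{\mathrm{fp}}\mathcal F(R)$, $\mathcal P_1\mathcal F(R)$). For a class $\mathcal C$ of right modules, $\varinjlim\mathcal C$ is the class of all modules that are direct limits of direct systems (over directed sets) of modules in $\mathcal C$. *)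

(* Defs.v *)
From HB Require Import structures.
From mathcomp Require Import all_boot all_order all_algebra.
From mathcomp Require Import generic_quotient ring_quotient.
From mathcomp Require Import boolp.
From mathcomp.multinomials Require Import freeg.

Set Implicit Arguments.
Unset Strict Implicit.
Unset Printing Implicit Defensive.

Import Order.Theory GRing.Theory.

Local Open Scope ring_scope.

(* A right R-module is a left module over the converse ring R^c: the right
   action of a on h is a *: h, with a read in R^c. Rings may be trivial. *)
Notation rmodType R := (lmodType (R^c)%type).

Definition surjective (A B : Type) (f : A -> B) : Prop :=
  forall y, exists x, f x = y.

Definition exact_at (A B : Type) (C : zmodType) (f : A -> B) (g : B -> C) :
    Prop :=
  forall y, g y = 0 <-> exists x, f x = y.

Section Tensor.
Variables (R : pzRingType) (H : rmodType R) (M : lmodType R).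

Local Notation free := {freeg (H * M)%type}.

Inductive tensor_relation : free -> Prop :=
| tensor_rel0 : tensor_relation 0
| tensor_relB x y :
    tensor_relation x -> tensor_relation y -> tensor_relation (x - y)
| tensor_relDl h h' m :
    tensor_relation (<< (h + h', m) >> - << (h, m) >> - << (h', m) >>)
| tensor_relDr h m m' :
    tensor_relation (<< (h, m + m') >> - << (h, m) >> - << (h, m') >>)
| tensor_relZ (a : R) h m :
    tensor_relation (<< ((a : R^c) *: h, m) >> - << (h, a *: m) >>).

Definition tensor_rel (z : free) : bool := `[< tensor_relation z >].

Fact tensor_rel_closed : zmod_closed tensor_rel.
Proof.
split; first exact/asboolP/tensor_rel0.
move=> x y /asboolP hx /asboolP hy; exact/asboolP/tensor_relB.
Qed.

HB.instance Definition _ :=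
  GRing.isZmodClosed.Build free tensor_rel tensor_rel_closed.

Definition tensor : Type := Quotient.quot (GRing.ZmodClosed.clone free tensor_rel _).

HB.instance Definition _ := GRing.Zmodule.on tensor.
HB.instance Definition _ := Quotient.on tensor.

Definition tens (h : H) (m : M) : tensor :=
  \pi_tensor%qT << (h, m) >>.

Fact tensor_pi_eq (x y : free) :
  tensor_relation (x - y) -> \pi_tensor%qT x = \pi_tensor%qT y.
Proof. by move=> xy; apply/eqP; rewrite -Quotient.idealrBE; apply/asboolP. Qed.

Lemma tensDl h h' m : tens (h + h') m = tens h m + tens h' m.
Proof.
rewrite /tens -raddfD; apply: tensor_pi_eq; rewrite opprD addrA.
exact: tensor_relDl.
Qed.

Lemma tensDr h m m' : tens h (m + m') = tens h m + tens h m'.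
Proof.
rewrite /tens -raddfD; apply: tensor_pi_eq; rewrite opprD addrA.
exact: tensor_relDr.
Qed.

Lemma tensZ (a : R) h m : tens ((a : R^c) *: h) m = tens h (a *: m).
Proof. exact/tensor_pi_eq/tensor_relZ. Qed.

(* The additive map h ⊗ m |-> b h m, when b is additive in each argument and
   b ((a : R^c) *: h) m = b h (a *: m); it is computed on a representative. *)
Definition tensor_lift (A : zmodType) (b : H -> M -> A) (t : tensor) : A :=
  \sum_(k <- dom (repr t)) b k.1 k.2 *~ coeff k (repr t).

Section TensorLift.
Variables (A : zmodType) (b : H -> M -> A).
Hypothesis bDl : forall h h' m, b (h + h') m = b h m + b h' m.
Hypothesis bDr : forall h m m', b h (m + m') = b h m + b h m'.
Hypothesis bZ : forall (a : R) h m, b ((a : R^c) *: h) m = b h (a *: m).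

Let free_lift (z : free) : A := \sum_(k <- dom z) b k.1 k.2 *~ coeff k z.

Fact free_lift_seq (z : free) (s : seq (H * M)) :
  uniq s -> {subset dom z <= s} ->
  free_lift z = \sum_(k <- s) b k.1 k.2 *~ coeff k z.
Proof.
move=> us zs; rewrite (bigID (mem (dom z))) /= [X in _ + X]big1 ?addr0.
  rewrite -big_filter; apply: perm_big; apply: uniq_perm.
  - exact: uniq_dom.
  - exact: filter_uniq.
  by move=> k; rewrite mem_filter; case: (boolP (k \in dom z)) => //= /zs ->.
by move=> k /coeff_outdom ->; rewrite mulr0z.
Qed.

Fact free_liftB (x y : free) : free_lift (x - y) = free_lift x - free_lift y.
Proof.
pose s := undup (dom x ++ dom y).
have us : uniq s by exact: undup_uniq.
rewrite (@free_lift_seq (x - y) s) ?(@free_lift_seq x s) ?(@free_lift_seq y s) //.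
- rewrite -sumrB; apply: eq_bigr => k _.
  by rewrite coeffB mulrzBr.
- by move=> k; rewrite mem_undup mem_cat orbC => ->.
- by move=> k; rewrite mem_undup mem_cat => ->.
by move=> k /domB; rewrite mem_undup.
Qed.

Fact free_liftU h m : free_lift << (h, m) >> = b h m.
Proof. by rewrite /free_lift domU1 big_seq1 coeffU eqxx mulr1 mulr1z. Qed.

Fact free_lift_rel (z : free) : tensor_relation z -> free_lift z = 0.
Proof.
elim=> [|x y _ hx _ hy|h h' m|h m m'|a h m].
- by rewrite -[X in free_lift X](subrr 0) free_liftB subrr.
- by rewrite free_liftB hx hy subrr.
- by rewrite !free_liftB !free_liftU bDl addrAC addrK subrr.
- by rewrite !free_liftB !free_liftU bDr addrAC addrK subrr.
by rewrite !free_liftB !free_liftU bZ subrr.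
Qed.

Lemma tensor_lift_pi (z : free) : tensor_lift b (\pi_tensor%qT z) = free_lift z.
Proof.
rewrite /tensor_lift -/(free_lift _); apply/eqP; rewrite -subr_eq0 -free_liftB.
apply/eqP/free_lift_rel/asboolP.
have /eqP := reprK (\pi_tensor%qT z).
by rewrite -Quotient.idealrBE.
Qed.

Lemma tensor_lift_tens h m : tensor_lift b (tens h m) = b h m.
Proof. by rewrite tensor_lift_pi free_liftU. Qed.

Lemma tensor_lift_is_additive : zmod_morphism (tensor_lift b).
Proof.
move=> x y; rewrite -[x]reprK -[y]reprK -raddfB.
by rewrite !tensor_lift_pi free_liftB.
Qed.

End TensorLift.

End Tensor.

Section TensorMap.
Variables (R : pzRingType) (H H' : rmodType R) (M M' : lmodType R).
Variables (f : {linear H -> H'}) (g : {linear M -> M'}).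

Definition tensor_map : tensor H M -> tensor H' M' :=
  tensor_lift (fun h m => tens (f h) (g m)).

Let mapDl h h' m :
  tens (f (h + h')) (g m) = tens (f h) (g m) + tens (f h') (g m).
Proof. by rewrite raddfD tensDl. Qed.

Let mapDr h m m' :
  tens (f h) (g (m + m')) = tens (f h) (g m) + tens (f h) (g m').
Proof. by rewrite raddfD tensDr. Qed.

Let mapZ (a : R) h m :
  tens (f ((a : R^c) *: h)) (g m) = tens (f h) (g (a *: m)).
Proof. by rewrite !linearZ_LR tensZ. Qed.

Lemma tensor_map_tens h m : tensor_map (tens h m) = tens (f h) (g m).
Proof. exact: (tensor_lift_tens mapDl mapDr mapZ). Qed.

Lemma tensor_map_is_additive : zmod_morphism tensor_map.
Proof. exact: (tensor_lift_is_additive mapDl mapDr mapZ). Qed.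

HB.instance Definition _ :=
  GRing.isZmodMorphism.Build (tensor H M) (tensor H' M') tensor_map
    tensor_map_is_additive.

End TensorMap.

Definition projective (S : pzRingType) (P : lmodType S) : Prop :=
  forall (A B : lmodType S) (g : {linear A -> B}) (f : {linear P -> B}),
    surjective g -> exists k : {linear P -> A}, forall x, g (k x) = f x.

Definition flat (R : pzRingType) (F : rmodType R) : Prop :=
  forall (A B : lmodType R) (g : {linear A -> B}),
    injective g -> injective (tensor_map (idfun : {linear F -> F}) g).

(* H has a resolution 0 -> C1 -> C0 -> H -> 0 with terms in the class C. *)
Definition resolution_dim_le1 (S : pzRingType) (C : lmodType S -> Prop)
    (H : lmodType S) : Prop :=
  exists (C1 C0 : lmodType S) (i : {linear C1 -> C0}) (p : {linear C0 -> H}),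
    [/\ C C1, C C0, injective i, exact_at i p & surjective p].

Definition P1 (R : pzRingType) : rmodType R -> Prop :=
  resolution_dim_le1 (@projective R^c).

Definition F1 (R : pzRingType) : rmodType R -> Prop :=
  resolution_dim_le1 (@flat R).

Definition finitely_presented (S : pzRingType) (H : lmodType S) : Prop :=
  exists (m n : nat) (q : {linear 'rV[S]_m -> 'rV[S]_n})
         (p : {linear 'rV[S]_n -> H}),
    exact_at q p /\ surjective p.

Definition F1fp (R : pzRingType) (H : rmodType R) : Prop :=
  finitely_presented H /\ F1 H.

Record projective_resolution (S : pzRingType) (H : lmodType S) := {
  res_obj :> nat -> lmodType S;
  res_d : forall n, {linear res_obj n.+1 -> res_obj n};
  res_aug : {linear res_obj 0%N -> H};
  res_projective : forall n, projective (res_obj n);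
  res_exact : forall n, exact_at (res_d n.+1) (res_d n);
  res_exact0 : exact_at (res_d 0%N) res_aug;
  res_surj : surjective res_aug
}.

(* Tor_1(H, M) is the homology of P ⊗ M in degree 1, for P a projective
   resolution of H, and does not depend on P up to isomorphism. *)
Definition Tor1_eq0 (R : pzRingType) (H : rmodType R) (M : lmodType R) : Prop :=
  forall P : projective_resolution H,
    exact_at (tensor_map (res_d P 1%N) (idfun : {linear M -> M}))
             (tensor_map (res_d P 0%N) (idfun : {linear M -> M})).

Definition rel_flat (R : pzRingType) (C : rmodType R -> Prop)
    (M : lmodType R) : Prop :=
  forall H : rmodType R, C H -> Tor1_eq0 H M.

Record direct_system (S : pzRingType) (d : Order.disp_t)
    (I : preorderType d) := {
  ds_obj :> I -> lmodType S;
  ds_map : forall i j, (i <= j)%O -> {linear ds_obj i -> ds_obj j};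
  ds_map_id : forall i (ii : (i <= i)%O) x, ds_map ii x = x;
  ds_map_comp : forall i j k (ij : (i <= j)%O) (jk : (j <= k)%O)
      (ik : (i <= k)%O) x,
    ds_map jk (ds_map ij x) = ds_map ik x
}.

Definition directed (d : Order.disp_t) (I : preorderType d) : Prop :=
  inhabited I /\ forall i j : I, exists k, (i <= k)%O /\ (j <= k)%O.

Definition cocone (S : pzRingType) (d : Order.disp_t) (I : preorderType d)
    (D : direct_system S I) (L : lmodType S)
    (u : forall i, {linear D i -> L}) : Prop :=
  forall i j (ij : (i <= j)%O) x, u j (ds_map D ij x) = u i x.

Definition is_direct_limit (S : pzRingType) (d : Order.disp_t)
    (I : preorderType d) (D : direct_system S I) (L : lmodType S)
    (u : forall i, {linear D i -> L}) : Prop :=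
  cocone u /\
  forall (N : lmodType S) (v : forall i, {linear D i -> N}), cocone v ->
    exists w : {linear L -> N},
      (forall i x, w (u i x) = v i x) /\
      (forall w' : {linear L -> N},
         (forall i x, w' (u i x) = v i x) -> forall y, w' y = w y).

Definition direct_limits (S : pzRingType) (C : lmodType S -> Prop)
    (L : lmodType S) : Prop :=
  exists (d : Order.disp_t) (I : preorderType d) (D : direct_system S I)
         (u : forall i, {linear D i -> L}),
    [/\ directed I, forall i, C (D i) & is_direct_limit u].

(* Main.v *)
(* Each of the three kinds of flatness implies the next, cyclically.
   From F1 to F1fp there is nothing to do. From F1fp to P1: up to split
   injections, the map in a projective resolution 0 -> C1 -> C0 -> H -> 0 is the
   restriction of an injection between free modules, which is a directed union of
   injections between finitely generated free modules; the cokernels of the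
   latter are in F1fp. From P1 to F1: by hypothesis a module in F1 is a direct
   limit of modules in P1, and the vanishing of Tor_1(-, M) passes to direct
   limits. Throughout, Tor_1(H, M) = 0 is used in the form: every short exact
   sequence 0 -> A -> B -> H -> 0 stays exact after tensoring with M. *)
Require Import Defs.
From HB Require Import structures.
From mathcomp Require Import all_boot all_order all_algebra.
From mathcomp Require Import generic_quotient ring_quotient boolp.
From mathcomp.multinomials Require Import freeg.

Set Implicit Arguments.
Unset Strict Implicit.
Unset Printing Implicit Defensive.

Import Order.Theory GRing.Theory.

Local Open Scope ring_scope.

(** * Quotients, submodules and products *)

Definition linear_of (S : pzRingType) (U V : lmodType S) (f : U -> V)
    (lf : linear f) : {linear U -> V} :=
  HB.pack f (GRing.isLinear.Build S U V *:%R f lf).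

Section QuotientModule.
Variables (S : pzRingType) (V : lmodType S) (P : zmodClosed V).
Hypothesis PZ : forall (a : S) x, x \in P -> a *: x \in P.

(** Closure of [P] under scaling is an argument of the type itself, so that the module structure
    below can be inferred from the type. *)
Definition modquot of (forall (a : S) x, x \in P -> a *: x \in P) : Type :=
  Quotient.quot P.
Local Notation Q := (modquot PZ).
HB.instance Definition _ := GRing.Zmodule.on Q.
HB.instance Definition _ := Quotient.on Q.

Definition modquot_scale (a : S) (x : Q) : Q := \pi_Q%qT (a *: repr x).

Fact modquot_pi_eq (x y : V) : (\pi_Q%qT x == \pi_Q%qT y) = (x - y \in P).
Proof. by rewrite -Quotient.idealrBE. Qed.

Fact modquot_scale_pi a (x : V) :
  modquot_scale a (\pi_Q%qT x) = \pi_Q%qT (a *: x).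
Proof.
apply/eqP; rewrite modquot_pi_eq -scalerBr PZ // -modquot_pi_eq.
by rewrite reprK.
Qed.

Fact modquot_scaleA a b x :
  modquot_scale a (modquot_scale b x) = modquot_scale (a * b) x.
Proof. by rewrite -[x]reprK (modquot_scale_pi b) !modquot_scale_pi scalerA. Qed.

Fact modquot_scale1 : left_id 1 modquot_scale.
Proof. by move=> x; rewrite -[x]reprK modquot_scale_pi scale1r. Qed.

Fact modquot_scaleDr : right_distributive modquot_scale +%R.
Proof.
move=> a x y; rewrite -[x]reprK -[y]reprK -raddfD !modquot_scale_pi.
by rewrite scalerDr raddfD.
Qed.

Fact modquot_scaleDl x : {morph modquot_scale^~ x : a b / a + b}.
Proof.
move=> a b /=; rewrite -[x]reprK !modquot_scale_pi.
by rewrite scalerDl raddfD.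
Qed.

HB.instance Definition _ := GRing.Zmodule_isLmodule.Build S Q
  modquot_scaleA modquot_scale1 modquot_scaleDr modquot_scaleDl.

Fact modquot_pi_linear : linear (\pi_Q%qT : V -> Q).
Proof. by move=> a x y; rewrite raddfD /= -modquot_scale_pi. Qed.

End QuotientModule.

Section Submodule.
Variables (S : pzRingType) (V : lmodType S) (P : V -> Prop).
Hypotheses (P0 : P 0) (PD : forall a x y, P x -> P y -> P (a *: x + y)).

Let Pb : {pred V} := fun x => `[< P x >].

Let Pb_zmod : zmod_closed Pb.
Proof.
split=> [|x y /asboolP Px /asboolP Py]; first exact/asboolP.
by apply/asboolP; rewrite addrC -scaleN1r; apply: PD.
Qed.

Let Pb_scale (a : S) x : x \in Pb -> a *: x \in Pb.
Proof. by move=> /asboolP Px; apply/asboolP; rewrite -[_ *: _]addr0; apply: PD. Qed.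

Lemma quotient_module : exists (Q : lmodType S) (q : {linear V -> Q}),
  surjective q /\ forall x, q x = 0 <-> P x.
Proof.
pose I : zmodClosed V := HB.pack Pb (GRing.isZmodClosed.Build V Pb Pb_zmod).
have IZ : forall (a : S) x, x \in I -> a *: x \in I by exact: Pb_scale.
exists (modquot IZ), (linear_of (modquot_pi_linear IZ)); split=> [y|x] /=.
  by exists (repr y); rewrite /= reprK.
rewrite -[0](raddf0 (\pi_(modquot IZ)%qT)); split.
  by move/eqP; rewrite modquot_pi_eq subr0 => /asboolP.
by move=> Px; apply/eqP; rewrite modquot_pi_eq subr0; apply/asboolP.
Qed.

Lemma submodule : exists (K : lmodType S) (i : {linear K -> V}),
  injective i /\ forall x, P x <-> exists y, i y = x.
Proof.
have cP : submod_closed Pb.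
  split=> [|a x y /asboolP Px /asboolP Py]; first exact/asboolP.
  exact/asboolP/PD.
pose K : choiceType := HB.pack {x : V | Pb x} [Choice of {x : V | Pb x} by <:].
pose KM : lmodType S :=
  HB.pack K (GRing.SubChoice_isSubLmodule.Build S V Pb K (GRing.submod_closed_semi cP)).
have iL : linear (val : KM -> V) by move=> a x y.
exists KM, (linear_of iL); split=> [|x]; first exact: val_inj.
split=> [Px|[y <-]]; last exact/asboolP/(valP y).
by exists (exist _ x (introT (asboolP (P x)) Px)).
Qed.

End Submodule.

Lemma linear_factor (S : pzRingType) (E K V : lmodType S)
    (i : {linear K -> V}) (f : {linear E -> V}) :
  injective i -> (forall x, exists y, i y = f x) ->
  exists g : {linear E -> K}, forall x, i (g x) = f x.
Proof.
move=> inji ex; have [g gE] := choice ex.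
have lg : linear g by move=> a x y; apply: inji; rewrite linearP !gE linearP.
by exists (linear_of lg).
Qed.

Section DependentProduct.
Variables (S : pzRingType) (I : Type) (D : I -> lmodType S).

Definition dprod : Type := forall i, D i.

HB.instance Definition _ := gen_eqMixin dprod.
HB.instance Definition _ := gen_choiceMixin dprod.

Let add (f g : dprod) : dprod := fun i => f i + g i.
Let opp (f : dprod) : dprod := fun i => - f i.
Let zero : dprod := fun i => 0.
Let scale a (f : dprod) : dprod := fun i => a *: f i.

Let addA : associative add.
Proof. by move=> f g h; apply: functional_extensionality_dep => i; apply: addrA. Qed.
Let addC : commutative add.
Proof. by move=> f g; apply: functional_extensionality_dep => i; apply: addrC. Qed.
Let add0 : left_id zero add.
Proof. by move=> f; apply: functional_extensionality_dep => i; apply: add0r. Qed.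
Let addN : left_inverse zero opp add.
Proof. by move=> f; apply: functional_extensionality_dep => i; apply: addNr. Qed.

HB.instance Definition _ := GRing.isZmodule.Build dprod addA addC add0 addN.

Let scaleA a b f : scale a (scale b f) = scale (a * b) f.
Proof. by apply: functional_extensionality_dep => i; apply: scalerA. Qed.
Let scale1 : left_id 1 scale.
Proof. by move=> f; apply: functional_extensionality_dep => i; apply: scale1r. Qed.
Let scaleDr : right_distributive scale +%R.
Proof. by move=> a f g; apply: functional_extensionality_dep => i; apply: scalerDr. Qed.
Let scaleDl f : {morph scale^~ f : a b / a + b}.
Proof. by move=> a b; apply: functional_extensionality_dep => i; apply: scalerDl. Qed.

HB.instance Definition _ :=
  GRing.Zmodule_isLmodule.Build S dprod scaleA scale1 scaleDr scaleDl.

End DependentProduct.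

(** * Right exactness of the tensor product *)

Section TensorTheory.
Variables (R : pzRingType) (M : lmodType R).
Implicit Types H : rmodType R.

(** Every tensor is an integral combination of pure tensors, and closure under differences yields
    negatives, sums and integer multiples. *)
Lemma tensor_ind H (P : tensor H M -> Prop) :
  P 0 -> (forall x y, P x -> P y -> P (x - y)) ->
  (forall h m, P (tens h m)) -> forall t, P t.
Proof.
move=> P0 PB Pt t; have PN x : P x -> P (- x) by rewrite -sub0r; apply: PB.
have PD x y : P x -> P y -> P (x + y).
  by move=> Px Py; rewrite -[y]opprK; apply/PB/PN.
rewrite -[t]reprK -[repr t]freeg_sumE raddf_sum /=.
elim/big_rec: _ => // -[h m] x _ Px; apply: (PD _ _ _ Px).
set z := coeff _ _; have PMn n : P (tens h m *+ n).
  by elim: n => [|n Pn]; rewrite ?mulr0n // mulrSr; apply: PD.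
have -> : << z *g (h, m) >> = << (h, m) >> *~ z :> {freeg (H * M)%type}.
  by rewrite freegU_mulz intz.
rewrite raddfMz; case: z => n; first exact: PMn.
by rewrite NegzE mulrNz; apply/PN/PMn.
Qed.

Lemma tens0l H (m : M) : tens (0 : H) m = 0.
Proof. by apply: (addIr (tens 0 m)); rewrite -tensDl !add0r. Qed.

Lemma tens_suml H (I : Type) (r : seq I) (F : I -> H) (m : M) :
  tens (\sum_(i <- r) F i) m = \sum_(i <- r) tens (F i) m.
Proof.
apply: (big_morph (fun h : H => tens h m)) => [x y|]; last exact: tens0l.
exact: tensDl.
Qed.

Definition tmap H H' (f : {linear H -> H'}) : tensor H M -> tensor H' M :=
  tensor_map f (idfun : {linear M -> M}).
HB.instance Definition _ H H' (f : {linear H -> H'}) :=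
  GRing.Additive.on (tmap f).

Lemma tmap_tens H H' (f : {linear H -> H'}) h m :
  tmap f (tens h m) = tens (f h) m.
Proof. exact: tensor_map_tens. Qed.

Lemma tmap_comp H1 H2 H3 (f : {linear H1 -> H2}) (g : {linear H2 -> H3})
    (h : {linear H1 -> H3}) :
  (forall x, g (f x) = h x) -> forall t, tmap g (tmap f t) = tmap h t.
Proof.
move=> gf; apply: tensor_ind => [|x y gx gy|x m].
- by rewrite !raddf0.
- by rewrite !raddfB /= gx gy.
by rewrite !tmap_tens gf.
Qed.

Lemma tmap_id H (f : {linear H -> H}) :
  (forall x, f x = x) -> forall t, tmap f t = t.
Proof.
move=> f1; apply: tensor_ind => [|x y gx gy|x m].
- by rewrite !raddf0.
- by rewrite !raddfB /= gx gy.
by rewrite !tmap_tens f1.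
Qed.

Lemma tmap_zero H H' (f : {linear H -> H'}) :
  (forall x, f x = 0) -> forall t, tmap f t = 0.
Proof.
move=> f0; apply: tensor_ind => [|x y gx gy|x m].
- by rewrite !raddf0.
- by rewrite !raddfB /= gx gy subr0.
by rewrite !tmap_tens f0 tens0l.
Qed.

Lemma tmap_cancel H H' (f : {linear H -> H'}) (g : {linear H' -> H}) :
  cancel f g -> cancel (tmap f) (tmap g).
Proof. by move=> fK t; rewrite (tmap_comp (h := idfun)) // tmap_id. Qed.

Lemma tmap_inj0 H H' (f : {linear H -> H'}) :
  (forall t, tmap f t = 0 -> t = 0) <-> injective (tmap f).
Proof.
split=> [f0 x y fxy|inj t]; last by rewrite -(raddf0 (tmap f)) => /inj.
by apply/eqP; rewrite -subr_eq0; apply/eqP/f0; rewrite raddfB /= fxy subrr.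
Qed.

(* The cokernel Q of [tmap f] receives a map from C ⊗ M, sending g b ⊗ m to the
   class of b ⊗ m, which is inverse to the induced map Q -> C ⊗ M. *)
Lemma tensor_right_exact (A B C : rmodType R) (f : {linear A -> B})
    (g : {linear B -> C}) :
  exact_at f g -> surjective g -> exact_at (tmap f) (tmap g).
Proof.
move=> fg gs t; split; last first.
  move=> [s <-]; rewrite (@tmap_comp _ _ _ _ _ \0) ?tmap_zero // => x.
  by apply/fg; exists x.
(* [zmodule] regards the abelian group as a module over the integers, so its cokernel is obtained
   from [quotient_module]. *)
pose P (t : zmodule (tensor B M)) := exists s, tmap f s = t.
have [||Q [q [_ q0]]] := @quotient_module _ _ P; rewrite /P.
- by exists 0; rewrite raddf0.
- move=> a _ _ [x <-] [y <-]; exists (x *~ a + y).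
  by rewrite raddfD raddfMz.
have [h hK] := choice gs.
pose b (c : C) (m : M) : Q := q (tens (h c) m).
(* The section [h] is only a map of sets, but modulo the image of [tmap f] the class of [tens x m]
   depends only on [g x]; this makes [b] balanced. *)
have qE x y m : g x = g y -> q (tens x m) = q (tens y m).
  move=> gxy; have [|z fz] := (fg (x - y)).1; first by rewrite raddfB /= gxy subrr.
  apply/eqP; rewrite -subr_eq0 -raddfB; apply/eqP/q0.
  exists (tens z m); rewrite tmap_tens fz.
  by apply: (canRL (addrK _)); rewrite -tensDl subrK.
have bDl c c' m : b (c + c') m = b c m + b c' m.
  by rewrite /b -raddfD -tensDl; apply: qE; rewrite raddfD /= !hK.
have bDr c m m' : b c (m + m') = b c m + b c m'.
  by rewrite /b -raddfD -tensDr.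
have bZ (a : R) c m : b ((a : R^c) *: c) m = b c (a *: m).
  by rewrite /b -tensZ; apply: qE; rewrite linearZ_LR !hK.
have lE : forall t, tensor_lift b (tmap g t) = q t.
  apply: tensor_ind => [|x y gx gy|x m].
  - by rewrite !raddf0 -(subrr 0) (tensor_lift_is_additive bDl bDr bZ) subrr.
  - by rewrite raddfB (tensor_lift_is_additive bDl bDr bZ) gx gy -raddfB.
  by rewrite tmap_tens tensor_lift_tens //; apply: qE; rewrite hK.
move=> gt; apply/q0; rewrite -lE gt.
by rewrite -(subrr 0) (tensor_lift_is_additive bDl bDr bZ) subrr.
Qed.

End TensorTheory.

(** * Vanishing of Tor and purity *)

Section Purity.
Variables (R : pzRingType) (M : lmodType R).

Local Notation "f '⊗M'" := (tmap (M := M) f) (at level 8).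

(** A form of [Tor_1(H, M) = 0] that mentions no resolution; only injectivity is asked, since
    tensoring is right exact in any case. *)
Definition Tor1_pure (H : rmodType R) : Prop :=
  forall (A B : rmodType R) (i : {linear A -> B}) (p : {linear B -> H}),
    injective i -> exact_at i p -> surjective p -> injective i⊗M.

(* B is the pushout of A <- K -> P, so K -> A ⊕ P -> B -> 0 stays exact after
   tensoring with M. *)
Lemma projective_Tor1_pure (H K P : rmodType R) (k : {linear K -> P})
    (q : {linear P -> H}) :
  projective P -> exact_at k q -> surjective q -> injective k⊗M ->
  Tor1_pure H.
Proof.
move=> projP kq qs kM A B i p inji ip ps.
have [f fE] := projP _ _ p q ps.
have [|d dE] := @linear_factor _ _ _ _ i (f \o k) inji.
  by move=> x; apply/ip; rewrite /= fE; apply/kq; exists x.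
have lj : linear (fun x => (- d x, k x) : A * P).
  by move=> a x y; congr (_, _); rewrite /= linearP //= opprD scalerN.
have ls : linear (fun x : A * P => i x.1 + f x.2).
  by move=> a x y; rewrite /= !linearP scalerDr addrACA.
have l1 : linear (fun x : A => (x, 0) : A * P).
  by move=> a x y; congr (_, _); rewrite /= scaler0 addr0.
have js : exact_at (linear_of lj) (linear_of ls).
  move=> [a x]; split=> /= [sax|[y [<- <-]]]; last first.
    by rewrite raddfN /= dE addNr.
  have /kq [y yx] : q x = 0.
    rewrite -fE -[f x](addKr (i a)) sax addr0 raddfN /=.
    by rewrite (ip (i a)).2 ?oppr0 //; exists a.
  exists y; rewrite yx; congr (_, _); apply: inji.
  by rewrite raddfN /= dE /= yx; apply/esym/eqP; rewrite -addr_eq0 sax.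
have ss : surjective (linear_of ls).
  move=> b; have [x xb] := qs (p b).
  have [|a ab] := (ip (b - f x)).1; first by rewrite raddfB /= fE xb subrr.
  by exists (a, x) => /=; rewrite ab subrK.
apply/tmap_inj0 => t it0.
(* Embedded in the first summand, [t] is killed by the sum map, so it comes from some [u] over [K].
   The second component gives [tmap k u = 0], hence [u = 0], and the first component then gives
   [t = 0]. *)
have [|u uE] := (tensor_right_exact (M := M) js ss (tmap (linear_of l1) t)).1.
  by rewrite (tmap_comp (h := i)) // => x /=; rewrite raddf0 addr0.
suff u0 : u = 0.
  have := tmap_cancel (f := linear_of l1) (g := fst) (fun x => erefl) t.
  by rewrite -uE u0 !raddf0.
apply: ((tmap_inj0 _ k).2 kM).
rewrite -(tmap_comp (f := linear_of lj) (g := snd)) // uE.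
by rewrite (tmap_comp (h := \0)) // tmap_zero.
Qed.

(** The quotient [K] of degree 1 by the image of degree 2 embeds in degree 0 as the kernel of the
    augmentation. Purity keeps this embedding injective, so a cycle dies in [tensor K M], and right
    exactness makes it a boundary. *)
Lemma Tor1_pure_eq0 (H : rmodType R) : Tor1_pure H -> Tor1_eq0 H M.
Proof.
move=> pureH P; rewrite /exact_at -!/(tmap _).
set d1 := res_d P 1%N; set d0 := res_d P 0%N.
have d10 : exact_at d1 d0 by exact: res_exact.
move=> t; split; last first.
  move=> [s <-]; rewrite (tmap_comp (h := \0)) ?tmap_zero // => x.
  by apply: (d10 _).2; exists x.
have [||K [q [qs q0]]] := @quotient_module _ _ (fun y => exists x, d1 x = y).
- by exists 0; rewrite raddf0.
- by move=> a _ _ [x <-] [y <-]; exists (a *: x + y); rewrite linearP.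
have [h hK] := choice qs.
have d0E y : d0 (h (q y)) = d0 y.
  apply/eqP; rewrite -subr_eq0 -raddfB; apply/eqP/d10/q0.
  by rewrite raddfB /= hK subrr.
have li : linear (d0 \o h).
  move=> a x y; rewrite /= -{1}[x]hK -{1}[y]hK -linearP d0E.
  by rewrite linearP.
have iK y : linear_of li (q y) = d0 y by exact: d0E.
have inji : injective (linear_of li).
  apply: raddf_inj => x; have [y <-] := qs x; rewrite /= d0E.
  by move/d10/q0.
have ip : exact_at (linear_of li) (res_aug P).
  move=> y; split=> [/res_exact0[x <-]|[x <-]]; first by exists (q x).
  by apply/res_exact0; have [y' <-] := qs x; exists y'.
move=> t0; have qt : tmap q t = 0.
  apply: (pureH _ _ _ _ inji ip (@res_surj _ _ P)).
  by rewrite (tmap_comp (h := d0)) // t0 raddf0.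
have ex : exact_at d1 q by move=> y; apply: q0.
exact/(tensor_right_exact ex qs t).
Qed.
End Purity.

Lemma row_vector_projective (S : pzRingType) n : projective 'rV[S]_n.
Proof.
move=> A B g f gs.
have [h hK] := choice (fun i : 'I_n => gs (f (delta_mx 0 i))).
have lk : linear (fun v : 'rV[S]_n => \sum_i v 0 i *: h i).
  move=> a u v; rewrite scaler_sumr -big_split; apply: eq_bigr => i _ /=.
  by rewrite !mxE scalerDl scalerA.
exists (linear_of lk) => v; rewrite [in RHS](row_sum_delta v) !linear_sum.
by apply: eq_bigr => i _; rewrite !linearZ /= hK.
Qed.

Section Resolution.
Variables (S : pzRingType) (H C1 C0 : lmodType S).
Variables (i : {linear C1 -> C0}) (p : {linear C0 -> H}).
Hypotheses (proj1 : projective C1) (proj0 : projective C0).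
Hypotheses (inji : injective i) (ip : exact_at i p) (ps : surjective p).

(** Resolutions are indexed by all of [nat], so the short one is continued by the zero module,
    realised as ['rV[S]_0]. *)
Let obj n : lmodType S := match n with 0 => C0 | 1 => C1 | _ => 'rV[S]_0 end%N.

Let d n : {linear obj n.+1 -> obj n} :=
  match n return {linear obj n.+1 -> obj n} with 0 => i | _ => \0 end%N.

Let obj_projective n : projective (obj n).
Proof. by case: n => [|[|n]] //=; apply: row_vector_projective. Qed.

Let d_exact n : exact_at (d n.+1) (d n).
Proof.
case: n => [|n] y; split=> /=.
- by move=> iy; exists 0; apply: inji; rewrite iy raddf0.
- by move=> [_ <-]; rewrite raddf0.
- by exists 0; rewrite [y]thinmx0.
by [].
Qed.

Definition two_term_resolution : projective_resolution H :=
  Build_projective_resolution obj_projective d_exact ip ps.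

End Resolution.

(** In the two-term resolution the differential from degree 2 is zero, so exactness in degree 1 says
    that [tmap i] has zero kernel. *)
Lemma Tor1_eq0_inj (R : pzRingType) (M : lmodType R) (H C1 C0 : rmodType R)
    (i : {linear C1 -> C0}) (p : {linear C0 -> H}) :
  projective C1 -> projective C0 -> injective i -> exact_at i p ->
  surjective p -> Tor1_eq0 H M -> injective (tmap (M := M) i).
Proof.
move=> proj1 proj0 inji ip ps T; apply/tmap_inj0 => t it.
have [s <-] := (T (two_term_resolution proj1 proj0 inji ip ps) t).1 it.
by rewrite /=; apply: tmap_zero.
Qed.

(** Tensoring [R^n] with [N] gives [N^n]: the coordinate [l N i] sends [tens v m] to [v_i m], a
    tensor is recovered from its coordinates, and the coordinates are natural in [N]. *)
Lemma row_vector_flat (R : pzRingType) n : flat ('rV[R^c]_n : rmodType R).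
Proof.
move=> A B g injg.
pose c (N : lmodType R) (i : 'I_n) (v : 'rV[R^c]_n) (m : N) : N :=
  (v 0 i : R) *: m.
have cDl N i v v' m : c N i (v + v') m = c N i v m + c N i v' m.
  by rewrite /c mxE scalerDl.
have cDr N i v m m' : c N i v (m + m') = c N i v m + c N i v m'.
  by rewrite /c scalerDr.
have cZ N i (a : R) v m : c N i ((a : R^c) *: v) m = c N i v (a *: m).
  by rewrite /c mxE scalerA.
pose l N i := tensor_lift (c N i).
have lB N i : zmod_morphism (l N i) := tensor_lift_is_additive (cDl N i) (cDr N i) (cZ N i).
have lt N i : forall v m, l N i (tens v m) = c N i v m :=
  tensor_lift_tens (cDl N i) (cDr N i) (cZ N i).
have l0 N i : l N i 0 = 0 by have := lB N i 0 0; rewrite !subrr.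
have lE N : forall t, \sum_i tens (delta_mx 0 i : 'rV[R^c]_n) (l N i t) = t.
  apply: tensor_ind => [|x y xE yE|v m].
  - by rewrite big1 // => i _; rewrite l0 -(scale0r 0) -tensZ scale0r tens0l.
  - rewrite -{2}xE -{2}yE -sumrB; apply: eq_bigr => i _.
    by rewrite lB; apply: (canRL (addrK _)); rewrite -tensDr subrK.
  rewrite {2}(row_sum_delta v).
  rewrite tens_suml.
  by apply: eq_bigr => i _; rewrite lt /c -tensZ.
have lg i : forall t, l B i (tensor_map (idfun : {linear 'rV[R^c]_n -> _}) g t) = g (l A i t).
  apply: tensor_ind => [|x y xE yE|v m].
  - by rewrite raddf0 !l0 raddf0.
  - by rewrite raddfB !lB /= xE yE raddfB.
  by rewrite tensor_map_tens !lt /c linearZ.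
move=> x y gxy; rewrite -[x]lE -[y]lE; apply: eq_bigr => i _; congr tens.
by apply: injg; rewrite -!lg gxy.
Qed.

(** * Free modules *)

(** Every finite subset lies in a finitely generated free direct summand, embedded by [u] with
    retraction [r]. Free modules are of this kind. *)
Definition locally_free (S : pzRingType) (G : lmodType S) : Prop :=
  forall s : seq G, exists (n : nat) (u : {linear 'rV[S]_n -> G})
    (r : {linear G -> 'rV[S]_n}), cancel u r /\ {in s, cancel r u}.

Lemma supported_sum (S : pzRingType) (V : lmodType S) (X : eqType)
    (f : X -> S) (v : X -> V) (s s' : seq X) :
  uniq s -> uniq s' -> (forall x, f x != 0 -> x \in s) ->
  (forall x, f x != 0 -> x \in s') ->
  \sum_(x <- s) f x *: v x = \sum_(x <- s') f x *: v x.
Proof.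
have restrict t : \sum_(x <- t) f x *: v x =
                  \sum_(x <- [seq x <- t | f x != 0]) f x *: v x.
  rewrite big_filter [LHS](bigID (fun x => f x != 0)) /=.
  by rewrite [X in _ + X]big1 ?addr0 // => x /negPn/eqP->; rewrite scale0r.
move=> us us' fs fs'; rewrite restrict [RHS]restrict.
apply: perm_big; apply: uniq_perm; try exact: filter_uniq.
by move=> x; rewrite !mem_filter; case: eqVneq => //= /[dup] /fs-> /fs'->.
Qed.

(* G is the module of finitely supported functions C -> S. *)
Lemma locally_free_cover (S : pzRingType) (C : lmodType S) :
  exists (G : lmodType S) (p : {linear G -> C}), locally_free G /\ surjective p.
Proof.
pose V := dprod (fun _ : C => S^o : lmodType S).
pose P (f : V) := exists s : seq C, forall x, f x != 0 -> x \in s.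
have [||G [i [inji Pi]]] := @submodule S V P.
- by exists [::] => x; rewrite eqxx.
- move=> a f g [s fs] [s' gs']; exists (s ++ s') => x; rewrite mem_cat.
  apply: contraR; rewrite negb_or => /andP[xs xs'].
  have -> : (a *: f + g) x = a * f x + g x by [].
  rewrite (contraNeq (fs x)) // (contraNeq (gs' x)) //.
  by rewrite mulr0 addr0.
have [s sP] := choice (fun g : G => (Pi (i g)).2 (ex_intro _ g erefl)).
(* An element [g] is a formal combination with coefficient [i g x] at [x], and [p] evaluates it in
   [C]; by [pE] any list containing the support gives the same value. *)
pose p (g : G) : C := \sum_(x <- undup (s g)) (i g x : S) *: x.
have pE g t : uniq t -> (forall x, i g x != 0 -> x \in t) ->
    p g = \sum_(x <- t) (i g x : S) *: x.
  move=> ut gt; apply: supported_sum => // [|x /sP]; first exact: undup_uniq.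
  by rewrite mem_undup.
have lp : linear p.
  move=> a f g; pose t := undup (s f ++ s g ++ s (a *: f + g)).
  rewrite !(@pE _ t) ?undup_uniq //;
    try by move=> x /sP; rewrite mem_undup !mem_cat => ->; rewrite ?orbT.
  rewrite scaler_sumr -big_split; apply: eq_bigr => x _ /=.
  rewrite scalerA -scalerDl; congr (_ *: _).
  by have -> : i (a *: f + g) = a *: i f + i g by rewrite linearP.
exists G, (linear_of lp); split; last first.
  move=> c; have [|g gE] := (Pi (fun x => (x == c)%:R)).1.
    by exists [:: c] => x; rewrite inE; apply: contraR => /negPf->; rewrite mulr0n eqxx.
  exists g => /=; rewrite (@pE g [:: c]) // gE; first by rewrite big_seq1 eqxx scale1r.
  by move=> x; rewrite inE; apply: contraR => /negPf->; rewrite mulr0n eqxx.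
move=> l; pose t := undup (flatten (map s l)); pose n := size t.
(* Extension by zero: for [x] outside [t] the index is [size t], which is not below [n], so [insub]
   fails. *)
pose w (v : 'rV[S]_n) : V :=
  fun x => if insub (index x t) is Some k then v 0 k else 0.
have lw : linear w.
  move=> a v v'; apply: functional_extensionality_dep => x.
  rewrite -[RHS]/(a * w v x + w v' x) /w.
  by case: insub => [k|]; rewrite ?mxE // mulr0 addr0.
have [|u uE] := @linear_factor _ _ _ _ i (linear_of lw) inji.
  move=> v; apply/Pi; exists t => x; rewrite /= /w; case: insubP => [k + _ _|]; last by rewrite eqxx.
  by rewrite index_mem.
have lr : linear (fun g : G => \row_(k < n) (i g (nth 0 t k) : S)).
  move=> a f g; apply/rowP => k; rewrite !mxE.
  by have -> : i (a *: f + g) = a *: i f + i g by rewrite linearP.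
exists n, u, (linear_of lr); split.
  move=> v; apply/rowP => k; rewrite mxE uE /= /w.
  by rewrite index_uniq ?undup_uniq // valK.
move=> g gl; apply: inji; rewrite uE /= /w.
apply: functional_extensionality_dep => x.
case: insubP => [k _ kE|]; rewrite ?mxE ?kE.
  by rewrite nth_index // -index_mem -kE ltn_ord.
rewrite index_mem => xt; apply/esym/eqP; apply: contraR xt => /sP xg.
by rewrite mem_undup; apply/flatten_mapP; exists g.
Qed.

Lemma locally_free_prod (S : pzRingType) (G G' : lmodType S) :
  locally_free G -> locally_free G' -> locally_free (G * G')%type.
Proof.
move=> fG fG' s; have [n [u [r [uK rK]]]] := fG (map fst s).
have [n' [u' [r' [uK' rK']]]] := fG' (map snd s).
have lu : linear (fun v : 'rV[S]_(n + n') => (u (lsubmx v), u' (rsubmx v))).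
  by move=> a v w; congr (_, _); rewrite /= !linearP.
have lr : linear (fun g : G * G' => row_mx (r g.1) (r' g.2)).
  by move=> a v w; rewrite /= !linearP scale_row_mx add_row_mx.
exists (n + n')%N, (linear_of lu), (linear_of lr); split=> [v|[g g'] gs] /=.
  by rewrite uK uK' hsubmxK.
rewrite row_mxKl row_mxKr rK ?rK' //.
  by apply/mapP; exists (g, g').
by apply/mapP; exists (g, g').
Qed.

(* Injectivity of [tmap j] can be tested on the finitely generated free pieces,
   where the cokernel of the restriction of j lies in [F1fp]. *)
Lemma locally_free_tmap_inj (R : pzRingType) (M : lmodType R)
    (G G' : rmodType R) (j : {linear G -> G'}) :
  rel_flat (@F1fp R) M -> locally_free G -> locally_free G' -> injective j ->
  injective (tmap (M := M) j).
Proof.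
move=> flM fG fG' injj; apply/tmap_inj0 => t jt.
(* [s] collects the left factors of the pure tensors that make up [t]. *)
have [s sP] : exists s : seq G, forall f : {linear G -> G},
    {in s, forall x, f x = x} -> tmap f t = t.
  elim/tensor_ind: t {jt} => [|x y [s sP] [s' sP']|h m].
  - by exists [::] => f _; rewrite raddf0.
  - exists (s ++ s') => f fE; rewrite raddfB /= sP ?sP' //.
      by move=> z zs; apply: fE; rewrite mem_cat zs orbT.
    by move=> z zs; apply: fE; rewrite mem_cat zs.
  by exists [:: h] => f fE; rewrite tmap_tens fE ?mem_head.
have [m [u [r [uK rK]]]] := fG s.
(* The summand of [G'] is chosen to contain the images of the basis vectors, hence the whole image
   of [j \o u]; this makes [q] injective. *)
have [n [u' [r' [uK' rK']]]] := fG' [seq j (u (delta_mx 0 k)) | k : 'I_m].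
have ju v : u' (r' (j (u v))) = j (u v).
  rewrite (row_sum_delta v) !linear_sum; apply: eq_bigr => k _.
  by rewrite !linearZ /= rK' //; apply: image_f.
pose q : {linear 'rV[R^c]_m -> 'rV[R^c]_n} := r' \o (j \o u).
have injq : injective q.
  move=> v w /(congr1 u'); rewrite /= !ju => /injj.
  exact: (can_inj uK).
have [||H [p [ps p0]]] := @quotient_module _ _ (fun y => exists x, q x = y).
- by exists 0; rewrite raddf0.
- by move=> a _ _ [x <-] [y <-]; exists (a *: x + y); rewrite linearP.
have F1H : F1fp (H : rmodType R).
  split; first by exists m, n, q, p.
  exists 'rV[R^c]_m, 'rV[R^c]_n, q, p.
  by split=> //; apply: row_vector_flat.
have := Tor1_eq0_inj (@row_vector_projective _ m) (@row_vector_projective _ n)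
  injq p0 ps (flM _ F1H).
move/(tmap_inj0 _ q).2 => q_inj.
have <- : tmap (u \o r) t = t by apply: sP => x /rK.
(* [tmap q] kills [tmap r t], because [u \o r] fixes [t] and [tmap j t = 0]. *)
rewrite -(tmap_comp (f := r) (g := u)) // (q_inj (tmap r t)) ?raddf0 //.
rewrite -(tmap_comp (f := u) (g := r' \o j)) //.
have ut : tmap u (tmap r t) = t.
  by rewrite (tmap_comp (h := u \o r)) //; apply: sP => x /rK.
by rewrite ut -(tmap_comp (f := j) (g := r')) // jt raddf0.
Qed.

(* With a free cover r : G -> C1 split by s, the injection i extends to the
   injection g |-> (s0 (i (r g)), g - s (r g)) between free modules. *)
Lemma F1fp_flat_tmap_inj (R : pzRingType) (M : lmodType R)
    (C1 C0 : rmodType R) (i : {linear C1 -> C0}) :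
  rel_flat (@F1fp R) M -> projective C1 -> projective C0 -> injective i ->
  injective (tmap (M := M) i).
Proof.
move=> flM proj1 proj0 inji.
have [G1 [r1 [free1 surj1]]] := locally_free_cover C1.
have [G0 [r0 [free0 surj0]]] := locally_free_cover C0.
have [s1 s1K] := proj1 _ _ r1 idfun surj1.
have [s0 s0K] := proj0 _ _ r0 idfun surj0.
have lj : linear (fun g => (s0 (i (r1 g)), g - s1 (r1 g)) : G0 * G1).
  move=> a g h; congr (_, _); rewrite /= [r1 _]linearP; first by rewrite !linearP.
  by rewrite [s1 _]linearP /= opprD scalerBr addrACA.
have injj : injective (linear_of lj).
  apply: raddf_inj => g /= [/(congr1 r0)]; rewrite s0K raddf0 => /= irg.
  have -> : r1 g = 0 by apply: inji; rewrite irg raddf0.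
  by rewrite raddf0 subr0.
have l1 : linear (fun x : G0 => (x, 0) : G0 * G1).
  by move=> a x y; congr (_, _); rewrite /= scaler0 addr0.
have j_inj := locally_free_tmap_inj flM free1 (locally_free_prod free0 free1) injj.
apply/tmap_inj0 => t it.
(* [s1] is split by [r1], and the extension composed with [s1] is [(s0 \o i, 0)] because
   [r1 (s1 x) = x]. *)
suff s1t : tmap s1 t = 0 by rewrite -(tmap_cancel s1K t) s1t raddf0.
apply: ((tmap_inj0 _ (linear_of lj)).2 j_inj).
rewrite (tmap_comp (h := linear_of l1 \o (s0 \o i))) => [|x /=]; last first.
  by rewrite s1K subrr.
rewrite -(tmap_comp (f := i) (g := linear_of l1 \o s0)) // it.
exact: raddf0.
Qed.

Lemma P1_flat_of_F1fp_flat (R : pzRingType) (M : lmodType R) :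
  rel_flat (@F1fp R) M -> rel_flat (@P1 R) M.
Proof.
move=> flM H [C1 [C0 [i [p [proj1 proj0 inji ip ps]]]]].
apply: Tor1_pure_eq0.
exact: projective_Tor1_pure proj0 ip ps (F1fp_flat_tmap_inj flM proj1 proj0 inji).
Qed.

(** Tor is tested on one two-term resolution, and purity for all short exact sequences follows; the
    passage to direct limits uses this form. *)
Lemma P1_flat_pure (R : pzRingType) (M : lmodType R) (H : rmodType R) :
  rel_flat (@P1 R) M -> P1 H -> Tor1_pure M H.
Proof.
move=> flM HP; have T := flM _ HP.
move: HP => [C1 [C0 [i [p [proj1 proj0 inji ip ps]]]]].
exact: projective_Tor1_pure proj0 ip ps (Tor1_eq0_inj proj1 proj0 inji ip ps T).
Qed.

(** * Direct limits *)

Section DirectLimit.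
Variables (S : pzRingType) (d : Order.disp_t) (I : preorderType d).
Variables (D : direct_system S I) (L : lmodType S).
Variable u : forall i, {linear D i -> L}.
Hypotheses (dirI : directed I) (limu : is_direct_limit u).

(** By directedness the images of the [u i] together form a submodule. Its quotient map and the zero
    map both extend the zero cocone, so they agree by uniqueness. *)
Lemma direct_limit_surj y : exists i x, u i x = y.
Proof.
have [[i0] dir] := dirI; have [uc univ] := limu.
have [||Q [q [_ q0]]] := @quotient_module _ _ (fun y => exists i x, u i x = y).
- by exists i0, 0; rewrite raddf0.
- move=> a _ _ [i [x <-]] [j [x' <-]]; have [k [ik jk]] := dir i j.
  exists k, (a *: ds_map D ik x + ds_map D jk x').
  by rewrite linearP !uc.
have [|w [_ wU]] := univ Q (fun i => \0 : {linear D i -> Q}); first by [].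
apply/q0; rewrite (wU q) => [|i x /=]; last by apply/q0; exists i, x.
by rewrite -(wU \0).
Qed.

(** The product modulo the families that vanish from some index on. The ring [S'] is separate
    because families of tensor products are taken over the integers. *)
Lemma reduced_product (S' : pzRingType) (E : I -> lmodType S') :
  exists (Q : lmodType S') (q : {linear dprod E -> Q}),
    forall f, q f = 0 <-> exists k, forall j, (k <= j)%O -> f j = 0.
Proof.
have [[i0] dir] := dirI.
have [||Q [q [_ q0]]] := @quotient_module _ (dprod E)
    (fun f => exists k, forall j, (k <= j)%O -> f j = 0).
- by exists i0.
- move=> a f g [k fk] [l gl]; have [m [km lm]] := dir k l.
  exists m => j mj; have -> : (a *: f + g) j = a *: f j + g j by [].
  by rewrite fk ?gl ?scaler0 ?addr0 // (le_trans _ mj).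
by exists Q, q.
Qed.

(* Tested on the cocone into the reduced product of the D j that sends x in D i
   to the class of its images in the D j with i <= j. *)
Lemma direct_limit_eq0 i (x : D i) :
  u i x = 0 -> exists j (ij : (i <= j)%O), ds_map D ij x = 0.
Proof.
have [[i0] dir] := dirI; have [uc univ] := limu.
have [Q [q q0]] := reduced_product D.
(* Transition maps are made total in both indices, with default 0 when [k] does not precede [j]; the
   reduced product only sees large [j]. *)
have ext_ex k j : exists e : {linear D k -> D j},
    forall (kj : (k <= j)%O) y, e y = ds_map D kj y.
  have [kj|nkj] := pselect (k <= j)%O; last by exists \0 => kj; case: (nkj kj).
  by exists (ds_map D kj) => kj' y; rewrite (bool_irrelevance kj' kj).
pose e k j := projT1 (cid (ext_ex k j)).
have eE k j (kj : (k <= j)%O) y : e k j y = ds_map D kj y.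
  by rewrite /e; case: cid.
have lv k : linear (fun y => q ((fun j => e k j y) : dprod D)).
  move=> a y z; rewrite -linearP; congr (q _).
  by apply: functional_extensionality_dep => j; rewrite linearP.
have [|w [wu _]] := univ Q (fun k => linear_of (lv k)).
  move=> k l kl y /=; apply/eqP; rewrite -subr_eq0 -raddfB; apply/eqP/q0.
  exists l => j lj; have kj := le_trans kl lj.
  rewrite -[LHS]/(e l j (ds_map D kl y) - e k j y) (eE _ _ lj) (eE _ _ kj).
  by rewrite (ds_map_comp kl lj kj) subrr.
move=> ux; have /q0[k kE] : q ((fun j => e i j x) : dprod D) = 0.
  by rewrite -[LHS]/(linear_of (lv i) x) -wu ux raddf0.
have [j [ij kj]] := dir i k.
by exists j, ij; rewrite -eE; apply: kE.
Qed.

End DirectLimit.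

(* Pull 0 -> A -> B -> H -> 0 back to 0 -> A -> B_j -> D j -> 0. Every b in B
   lifts to an eventually coherent family in the B_j, unique from some stage on,
   which maps B ⊗ M to the reduced product of the B_j ⊗ M compatibly
   with the maps from A ⊗ M. *)
Lemma direct_limit_Tor1_pure (R : pzRingType) (M : lmodType R)
    (d : Order.disp_t) (I : preorderType d) (D : direct_system (R^c) I)
    (H : rmodType R) (u : forall i, {linear D i -> H}) :
  directed I -> is_direct_limit u -> (forall i, Tor1_pure M (D i)) ->
  Tor1_pure M H.
Proof.
move=> dirI limu pureD A B i p inji ip ps.
have [[i0] dir] := dirI; have [uc _] := limu.
(* [K j] is the pullback of [p] and [u j], written B_j above, and [k j] embeds it in [B * D j]. *)
have K_ex j : exists K : rmodType R, exists k : {linear K -> (B * D j)%type},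
    injective k /\ forall x, p x.1 = u j x.2 <-> exists y, k y = x.
  have [||K [k kP]] := @submodule _ (B * D j)%type (fun x => p x.1 = u j x.2).
  - by rewrite /= !raddf0.
  - by move=> a x y /= xE yE; rewrite !linearP /= xE yE.
  by exists K, k.
pose K j := projT1 (cid (K_ex j)).
have k_ex j : exists k : {linear K j -> (B * D j)%type},
    injective k /\ forall x, p x.1 = u j x.2 <-> exists y, k y = x.
  by rewrite /K; case: cid.
pose k j := projT1 (cid (k_ex j)).
have injk j : injective (k j) by rewrite /k; case: cid => ? [].
have kP j x : p x.1 = u j x.2 <-> exists y, k j y = x.
  by rewrite /k; case: cid => ? [].
have pi0 x : p (i x) = 0 by apply/ip; exists x.
have a_ex j : exists a : {linear A -> K j}, forall x, k j (a x) = (i x, 0).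
  have la : linear (fun x => (i x, 0) : B * D j).
    by move=> a x y; congr (_, _); rewrite /= ?linearP ?scaler0 ?addr0.
  apply: (@linear_factor _ _ _ _ (k j) (linear_of la) (injk j)) => x.
  by apply: (kP j (i x, 0)).1; rewrite /= pi0 raddf0.
pose a j := projT1 (cid (a_ex j)).
have aE j x : k j (a j x) = (i x, 0) by rewrite /a; case: cid.
have a_inj j : injective (tmap (M := M) (a j)).
  pose g : {linear K j -> D j} := snd \o k j.
  apply: (pureD j _ _ (a j) g).
  - by move=> x y /(congr1 (k j)); rewrite !aE => -[/inji].
  - move=> y; split=> [gy|[x <-]]; last by rewrite /g /= aE.
    have [|x xE] := (ip (k j y).1).1.
      by rewrite ((kP j (k j y)).2 _) ?[X in u j X]gy ?raddf0 //; exists y.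
    exists x; apply: injk; rewrite aE xE -[0]gy /g /=.
    by case: (k j y).
  move=> x; have [b bE] := ps (u j x).
  by have [y yE] := (kP j (b, x)).1 bE; exists y; rewrite /g /= yE.
have [Q [q q0]] := reduced_product dirI (fun j => zmodule (tensor (K j) M)).
(* A lift of [b]: from stage [l] on, the [D j] components are the images of one element [x] over
   [p b]. *)
pose thread (b : B) (f : dprod K) := exists l (x : D l), u l x = p b /\
  forall j (lj : (l <= j)%O), k j (f j) = (b, ds_map D lj x).
have thread_ex b : exists f, thread b f.
  have [l [x xb]] := direct_limit_surj dirI limu (p b).
  have f_ex j : exists y : K j, forall lj : (l <= j)%O, k j y = (b, ds_map D lj x).
    have [lj|nlj] := pselect (l <= j)%O; last by exists 0 => lj; case: (nlj lj).
    have [|y yE] := (kP j (b, ds_map D lj x)).1; first by rewrite /= uc.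
    by exists y => lj'; rewrite (bool_irrelevance lj' lj).
  exists (fun j => projT1 (cid (f_ex j))), l, x; split=> // j lj.
  by case: cid => /= y.
have thread_lin (r : R^c) b b' f f' :
    thread b f -> thread b' f' -> thread (r *: b + b') (r *: f + f').
  move=> [l [x [xb fE]]] [l' [x' [xb' fE']]]; have [m [lm lm']] := dir l l'.
  exists m, (r *: ds_map D lm x + ds_map D lm' x'); split.
    by rewrite !linearP /= !uc xb xb'.
  move=> j mj; have lj := le_trans lm mj; have lj' := le_trans lm' mj.
  rewrite -[(r *: f + f') j]/(r *: f j + f' j) linearP (fE _ lj) (fE' _ lj').
  congr (_, _); rewrite /= linearP.
  by rewrite (ds_map_comp lm mj lj) (ds_map_comp lm' mj lj').
(* The witness [x] lies over 0, so it dies at some later stage. Applied to differences, this shows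
   that two threads of one element eventually agree. *)
have thread0 f : thread 0 f -> exists l, forall j, (l <= j)%O -> f j = 0.
  move=> [l [x [xb fE]]]; rewrite raddf0 in xb.
  have [m [lm xm]] := direct_limit_eq0 dirI limu xb.
  exists m => j mj; have lj := le_trans lm mj.
  by apply: injk; rewrite (fE _ lj) -(ds_map_comp lm mj lj) xm !raddf0.
have [h hT] := choice thread_ex.
pose cl (f : dprod K) (m : M) : Q := q (fun j => tens (f j) m).
have clE b f g m : thread b f -> thread b g -> cl f m = cl g m.
  move=> fT gT; apply/eqP; rewrite -subr_eq0 -raddfB; apply/eqP/q0.
  have := thread_lin (-1) _ _ _ _ gT fT; rewrite scaleN1r addNr.
  move=> /thread0[l lE]; exists l => j lj.
  have := lE j lj; rewrite -[LHS]/(-1 *: g j + f j) scaleN1r addrC.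
  by move/subr0_eq => fg; rewrite -[LHS]/(tens (f j) m - tens (g j) m) fg subrr.
have clD f g m : cl (f + g) m = cl f m + cl g m.
  rewrite -raddfD; congr (q _); apply: functional_extensionality_dep => j.
  exact: tensDl.
pose b (x : B) (m : M) := cl (h x) m.
have bDl x x' m : b (x + x') m = b x m + b x' m.
  rewrite -clD; apply: clE (hT _) _.
  by have := thread_lin 1 _ _ _ _ (hT x) (hT x'); rewrite !scale1r.
have bDr x m m' : b x (m + m') = b x m + b x m'.
  rewrite -raddfD; congr (q _); apply: functional_extensionality_dep => j.
  exact: tensDr.
have bZ (r : R) x m : b ((r : R^c) *: x) m = b x (r *: m).
  transitivity (cl ((r : R^c) *: h x) m).
    apply: clE (hT _) _.
    have T0 : thread 0 0.
      by exists i0, 0; split=> [|j lj]; rewrite ?raddf0 //= !raddf0.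
    by have := thread_lin r _ _ _ _ (hT x) T0; rewrite !addr0.
  congr (q _); apply: functional_extensionality_dep => j.
  exact: tensZ.
(* The family [a j x] is a thread of [i x] with witness 0, so [b] restricted along [i] is computed
   by the maps [tmap (a j)], each of them injective. *)
have lE : forall t, tensor_lift b (tmap i t) = q (fun j => tmap (a j) t).
  apply: tensor_ind => [|x y xE yE|x m].
  - rewrite raddf0 -(subrr 0) (tensor_lift_is_additive bDl bDr bZ) subrr.
    apply/esym/q0; exists i0 => j _; exact: raddf0.
  - rewrite raddfB (tensor_lift_is_additive bDl bDr bZ) xE yE -raddfB.
    congr (q _); apply: functional_extensionality_dep => j.
    exact/esym/raddfB.
  rewrite tmap_tens tensor_lift_tens //.
  transitivity (cl (fun j => a j x) m).
    apply: clE (hT _) _; exists i0, 0; split=> [|j lj]; first by rewrite pi0 raddf0.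
    by rewrite aE raddf0.
  congr (q _); apply: functional_extensionality_dep => j.
  exact/esym/tmap_tens.
apply/tmap_inj0 => t it.
have /q0[l lE'] : q (fun j => tmap (a j) t) = 0.
  rewrite -lE it; have := tensor_lift_is_additive bDl bDr bZ 0 0.
  by rewrite !subrr.
exact: (tmap_inj0 _ (a l)).2 (a_inj l) t (lE' l (lexx l)).
Qed.

Theorem corollary2p11 (R : pzRingType)
  (hlim : forall H : rmodType R, direct_limits (@P1 R) H <-> F1 H) :
  forall M : lmodType R,
    (rel_flat (@P1 R) M <-> rel_flat (@F1fp R) M) /\
    (rel_flat (@F1fp R) M <-> rel_flat (@F1 R) M).
Proof.
move=> M.
have F1_P1 : rel_flat (@P1 R) M -> rel_flat (@F1 R) M.
  move=> flM H /hlim[d [I [D [u [dirI DP1 limu]]]]].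
  apply: Tor1_pure_eq0; apply: direct_limit_Tor1_pure dirI limu _ => i.
  exact: P1_flat_pure flM (DP1 i).
have F1fp_F1 : rel_flat (@F1 R) M -> rel_flat (@F1fp R) M.
  by move=> flM H [_ HF1]; apply: flM.
have P1_F1fp := @P1_flat_of_F1fp_flat R M.
by split; split; auto.
Qed.
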